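(* Let $A\in\mathbb{R}^{m\times n}$, let $x^\dagger$ (with values in $\mathbb{R}^n$) and $\varepsilon$ (with values in $\mathbb{R}^m$) be uncorrelated, square-integrable random variables with $\mathbb{E}(x^\dagger)=\mu_{x^\dagger}$, $\operatorname{Cov}(x^\dagger)=\Sigma_{x^\dagger}$, $\mathbb{E}(\varepsilon)=0$ and $\operatorname{Cov}(\varepsilon)=\Sigma_\varepsilon$. Let the matrices $A^TA$, $\Sigma_{x^\dagger}$ and $\Sigma_\varepsilon$ be invertible. The bilevel learning problem $$\min_{M,x_0}\ \mathbb{E}\,\|\hat x-x^\dagger\|^2\quad\text{s.t.}\quad \hat x=(A^TA+M)^{-1}\big(A^T(Ax^\dagger+\varepsilon)+Mx_0\big)$$ is solved by all $M$ and $x_0$ with $$x_0\in\mu_{x^\dagger}+\ker(M),\qquad M=A^T\Sigma_\varepsilon A(A^TA)^{-1}\Sigma_{x^\dagger}^{-1}.$$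
   Context: All random variables are defined on a fixed probability space. $\operatorname{Cov}(x)=\mathbb{E}\big((x-\mathbb{E}x)(x-\mathbb{E}x)^T\big)$. Uncorrelated means that the cross-covariance $\mathbb{E}\big((x^\dagger-\mathbb{E}x^\dagger)(\varepsilon-\mathbb{E}\varepsilon)^T\big)$ is zero. $\|\cdot\|$ is the Euclidean norm. The minimization runs over all $x_0\in\mathbb{R}^n$ and all (not necessarily symmetric) $M\in\mathbb{R}^{n\times n}$ such that $A^TA+M$ is invertible (so that $\hat x$ is defined). *)

(* Defs.v *)
From HB Require Import structures.
From mathcomp Require Import all_boot all_order all_algebra.
From mathcomp Require Import all_classical all_reals all_analysis.
Import Order.TTheory GRing.Theory Num.Theory.

Set Implicit Arguments.
Unset Strict Implicit.
Unset Printing Implicit Defensive.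

Local Open Scope classical_set_scope.
Local Open Scope ring_scope.

(* The library's norm `|v| on matrices is the max norm, hence this definition. *)
Definition enorm (R : realType) (n : nat) (v : 'cV[R]_n) : R :=
  Num.sqrt (\sum_(i < n) v i 0 ^+ 2).

(* Right kernel in column vectors; the library's kermx is the left (row)
   kernel. *)
Definition colker (R : realType) (m n : nat) (M : 'M[R]_(m, n)) :
  set 'cV[R]_n := [set v | M *m v = 0].

Section RandomVectors.
Context (d : measure_display) (T : measurableType d) (R : realType).
Variable P : probability T R.

(* 'cV[R]_n carries no measurableType structure; Borel measurability of a map
   into it is measurability of its coordinates. *)
Definition random_vector (n : nat) (x : T -> 'cV[R]_n) : Prop :=
  forall i : 'I_n, measurable_fun [set: T] (fun w => x w i 0).

Definition square_integrable (n : nat) (x : T -> 'cV[R]_n) : Prop :=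
  random_vector x /\ ('E_P[fun w => (enorm (x w) ^+ 2)%R] < +oo)%E.

(* [fine] sends infinite expectations to 0; every entry is finite in the uses
   below, where x is square-integrable. *)
Definition expectation_mx (p q : nat) (X : T -> 'M[R]_(p, q)) : 'M[R]_(p, q) :=
  \matrix_(i < p, j < q) fine 'E_P[fun w => X w i j].

Definition cross_covariance_mx (m n : nat)
    (x : T -> 'cV[R]_m) (y : T -> 'cV[R]_n) : 'M[R]_(m, n) :=
  expectation_mx
    (fun w => (x w - expectation_mx x) *m (y w - expectation_mx y)^T).

Definition covariance_mx (n : nat) (x : T -> 'cV[R]_n) : 'M[R]_n :=
  cross_covariance_mx x x.

Definition uncorrelated (m n : nat)
    (x : T -> 'cV[R]_m) (y : T -> 'cV[R]_n) : Prop :=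
  cross_covariance_mx x y = 0.

End RandomVectors.

Section BilevelLearning.
Context (R : realType) (m n : nat).
Variable A : 'M[R]_(m, n).

Definition feasible (M : 'M[R]_n) : Prop := A^T *m A + M \in unitmx.

Definition reconstruction (M : 'M[R]_n) (x0 : 'cV[R]_n) (y : 'cV[R]_m) :
    'cV[R]_n :=
  invmx (A^T *m A + M) *m (A^T *m y + M *m x0).

Context (d : measure_display) (T : measurableType d).
Variables (P : probability T R) (x : T -> 'cV[R]_n) (eps : T -> 'cV[R]_m).

Definition bilevel_risk (M : 'M[R]_n) (x0 : 'cV[R]_n) : \bar R :=
  'E_P[fun w => enorm (reconstruction M x0 (A *m x w + eps w) - x w) ^+ 2].

Definition solves_bilevel (M : 'M[R]_n) (x0 : 'cV[R]_n) : Prop :=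
  feasible M /\
  forall (M' : 'M[R]_n) (x0' : 'cV[R]_n), feasible M' ->
    (bilevel_risk M x0 <= bilevel_risk M' x0')%E.

End BilevelLearning.

(* Main.v *)
Require Import Defs.
From HB Require Import structures.
From mathcomp Require Import all_boot all_order all_algebra.
From mathcomp Require Import all_classical all_reals all_analysis.
From mathcomp Require Import measurable_realfun.
From mathcomp Require Import ring lra.
Import Order.TTheory GRing.Theory Num.Theory.

Set Implicit Arguments.
Unset Strict Implicit.
Unset Printing Implicit Defensive.

Local Open Scope classical_set_scope.
Local Open Scope ring_scope.

(** Write B = A^T A, S = Sigma_x, N = A^T Sigma_eps A. For a feasible M put
    G = (B + M)^-1 and K = G B, so that 1 - K = G M. The error of the
    reconstruction is then affine in the centred data,
      x^ - x = - (1 - K) (x - mu) + G A^T eps + (1 - K) (x0 - mu),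
    and since x and eps are uncorrelated and eps is centred, the risk splits as
      tr F(K) + |(1 - K) (x0 - mu)|^2,
      F(K) = (1 - K) S (1 - K)^T + K Q K^T,   Q = B^-1 N B^-1
    ([bilevel_riskE]); the noise term takes this form because G = K B^-1.

    F is quadratic in K. If K (S + Q) = S, completing the square gives
      F(K') = F(K) + (K' - K) (S + Q) (K' - K)^T
    for every K' ([error_covariance_square]), and the added term has
    nonnegative trace because S + Q is positive semidefinite. So such a K
    minimizes the first part of the risk over all matrices, whether or not they
    come from some M.

    The choice M = N B^-1 S^-1 is exactly the one with B + M = B (S + Q) S^-1,
    that is K (S + Q) = S. It is feasible because S is invertible, and a sum of
    positive semidefinite matrices is invertible as soon as one of them is
    ([psdmxD_unit]). Finally x0 - mu in ker M makes the bias
    (1 - K) (x0 - mu) = G M (x0 - mu) vanish, which minimizes the second part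
    of the risk. *)

(** * Positive semidefinite matrices *)

Section PositiveSemidefinite.
Context (R : realFieldType).

Definition psdmx (n : nat) (V : 'M[R]_n) : Prop :=
  V^T = V /\ forall v : 'rV[R]_n, 0 <= \tr (v *m V *m v^T).

Lemma psdmxD n (V W : 'M[R]_n) : psdmx V -> psdmx W -> psdmx (V + W).
Proof.
move=> [Vs Vp] [Ws Wp]; split; first by rewrite linearD /= Vs Ws.
by move=> v; rewrite mulmxDr mulmxDl linearD /= addr_ge0.
Qed.

Lemma psdmx_congr m n (C : 'M[R]_(m, n)) (V : 'M[R]_n) :
  psdmx V -> psdmx (C *m V *m C^T).
Proof.
move=> [Vs Vp]; split; first by rewrite !trmx_mul trmxK Vs mulmxA.
by move=> v; have := Vp (v *m C); rewrite trmx_mul !mulmxA.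
Qed.

(** The diagonal entries of C V C^T are the quadratic form of V at the rows
    of C. *)
Lemma mxtrace_congr_psd_ge0 m n (C : 'M[R]_(m, n)) (V : 'M[R]_n) :
  psdmx V -> 0 <= \tr (C *m V *m C^T).
Proof.
move=> [_ Vp]; rewrite /mxtrace sumr_ge0 // => i _.
have := Vp (row i C); rewrite trace_mx11 -row_mul tr_row !mxE.
by congr (0 <= _); apply: eq_bigr => j _; rewrite !mxE.
Qed.

(** With w = v V, the quadratic form of V at w + t v is affine in t with slope
    2 |w|^2; being nonnegative for all t, it must have slope 0. *)
Lemma psdmx_isotropic n (V : 'M[R]_n) (v : 'rV[R]_n) :
  psdmx V -> \tr (v *m V *m v^T) = 0 -> v *m V = 0.
Proof.
move=> [Vs Vp] v0; pose w := v *m V.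
have wwE : \tr (w *m w^T) = \sum_j w 0 j ^+ 2.
  by rewrite trace_mx11 mxE; apply: eq_bigr => j _; rewrite [w^T _ _]mxE.
suff ww0 : \tr (w *m w^T) = 0.
  apply/rowP => j; rewrite [RHS]mxE; apply/eqP; rewrite -sqrf_eq0.
  move: ww0; rewrite wwE => /psumr_eq0P -> // i _; exact: sqr_ge0.
have quadE t : \tr ((w + t *: v) *m V *m (w + t *: v)^T)
    = \tr (w *m V *m w^T) + t *+ 2 * \tr (w *m w^T).
  have -> : \tr (w *m w^T) = \tr (w *m V *m v^T).
    by rewrite {2}/w trmx_mul Vs mulmxA.
  have vVw : \tr (v *m V *m w^T) = \tr (w *m V *m v^T).
    by rewrite -mxtrace_tr trmx_mul trmxK trmx_mul Vs mulmxA.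
  rewrite linearD linearZ /= !(mulmxDl, mulmxDr) -!(scalemxAl, scalemxAr).
  rewrite !(linearD, linearZ) /= vVw v0; ring.
set a := \tr (w *m V *m w^T) in quadE.
set b := \tr (w *m w^T) in quadE *.
have b0 : 0 <= b by rewrite /b wwE sumr_ge0 // => j _; exact: sqr_ge0.
apply/eqP; rewrite eq_le b0 andbT leNgt; apply/negP => b_gt0.
(* The step t = - (a + 1) / b brings the quadratic form down to - a - 2. *)
have := Vp (w + (- ((a + 1) / b)) *: v); rewrite quadE.
have -> : a + - ((a + 1) / b) *+ 2 * b = - a - 2.
  by field; rewrite gt_eqF.
by have := Vp w; rewrite -/a; lra.
Qed.

(** A vector of the kernel of V + W is isotropic for V, because the two
    quadratic forms are nonnegative and add up to 0; hence it is in the kernel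
    of V. *)
Lemma psdmxD_unit n (V W : 'M[R]_n) :
  psdmx V -> psdmx W -> V \in unitmx -> V + W \in unitmx.
Proof.
move=> Vpsd Wpsd Vu; rewrite -row_free_unit -kermx_eq0.
apply/rowV0P => v /sub_kermxP vVW0.
have vV0 : \tr (v *m V *m v^T) = 0.
  apply/eqP; rewrite eq_le Vpsd.2 andbT.
  have := Wpsd.2 v; have : \tr (v *m (V + W) *m v^T) = 0.
    by rewrite vVW0 mul0mx linear0.
  by rewrite mulmxDr mulmxDl linearD /=; lra.
by rewrite -(mulmxK Vu v) (psdmx_isotropic Vpsd vV0) mul0mx.
Qed.

End PositiveSemidefinite.

(** * Completing the square *)

Section Gain.
Context (R : realFieldType) (n : nat).
Variables (S Q : 'M[R]_n).

(** Error covariance of the linear estimate K (x + n) of a centred x with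
    covariance S, from an uncorrelated noise n with covariance Q. *)
Definition error_covariance (K : 'M[R]_n) : 'M[R]_n :=
  (1%:M - K) *m S *m (1%:M - K)^T + K *m Q *m K^T.

(** The hypothesis K (S + Q) = S is the normal equation of the quadratic
    K |-> error_covariance K: it cancels the terms that are linear in K' - K.
    The identity holds between matrices, before taking traces. *)
Lemma error_covariance_square (K K' : 'M[R]_n) :
  S^T = S -> Q^T = Q -> K *m (S + Q) = S ->
  error_covariance K' =
    error_covariance K + (K' - K) *m (S + Q) *m (K' - K)^T.
Proof.
move=> Ss Qs KS.
have SK : (S + Q) *m K^T = S.
  by have := congr1 trmx KS; rewrite trmx_mul linearD /= Ss Qs.
have expand L : error_covariance L = S - L *m S - S *m L^T
    + L *m (S + Q) *m L^T.
  rewrite /error_covariance linearB /= trmx1.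
  rewrite !(mulmxBl, mulmxBr, mulmxDl, mulmxDr, mul1mx, mulmx1).
  by rewrite !mulNmx opprK !addrA; do 2 congr (_ + _); exact: addrAC.
rewrite !expand linearB /= !(mulmxBl, mulmxBr) -[K *m _ *m _]mulmxA.
rewrite -[K' *m _ *m K^T]mulmxA !SK !KS.
set a := K *m S; set b := S *m K^T.
set u := K' *m S; set v := S *m K'^T; set q := _ *m K'^T.
have -> : b = a by rewrite /a /b -{1}KS -mulmxA SK.
rewrite !opprB [q - _]addrC subrK [- v + q + _]addrCA [RHS]addrA subrK.
by rewrite -!addrA [- u + _]addrC -!addrA.
Qed.
End Gain.

(** * Expectations of matrix-valued random variables *)

Section MatrixExpectation.
Context (d : measure_display) (T : measurableType d) (R : realType).
Variable P : probability T R.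

(** Entrywise r-integrability. Linear maps preserve it, which reduces every
    integrability condition below to the entries of x and eps. *)
Definition mx_Lfun (r : R) (p q : nat) (X : T -> 'M[R]_(p, q)) : Prop :=
  forall i j, (fun w => X w i j) \in Lfun P r%:E.

Lemma Lfun_lincomb (p : R) (I : finType) (c : I -> R) (Y : I -> T -> R) :
  1 <= p -> (forall i, Y i \in Lfun P p%:E) ->
  (fun w => \sum_i c i * Y i w) \in Lfun P p%:E.
Proof.
move=> p1 LY; have p1E : (1 <= p%:E)%E by rewrite lee_fin.
rewrite (_ : (fun w => _) = \sum_i (Y i \* cst (c i))); last first.
  by apply/funext => w; rewrite fct_sumE; apply: eq_bigr => i _; exact: mulrC.
have [L0 LD] := Lfun_addr_closed P p1E.
by elim/big_ind: _ => // i _; exact: Lfun_scale.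
Qed.

Lemma expectation_lincomb (I : finType) (c : I -> R) (Y : I -> T -> R) :
  (forall i, Y i \in Lfun P 1) ->
  ('E_P[fun w => (\sum_i c i * Y i w)%R] = (\sum_i c i * fine 'E_P[Y i])%:E)%E.
Proof.
move=> LY.
have [_ LD] := Lfun_addr_closed P (lexx 1%E).
elim: (index_enum I) => [|i s IHs].
  rewrite big_nil (_ : (fun w => _) = cst 0) ?expectation_cst //.
  by apply/funext => w; rewrite big_nil.
have Ls : (fun w => \sum_(j <- s) c j * Y j w) \in Lfun P 1.
  elim: s {IHs} => [|j s IHs].
    rewrite (_ : (fun w => _) = cst 0) ?(Lfun_cst _ _ 1) //.
    by apply/funext => w; rewrite big_nil.
  rewrite (_ : (fun w => _) =
    (Y j \* cst (c j)) + (fun w => \sum_(j <- s) c j * Y j w)); last first.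
    by apply/funext => w; rewrite big_cons mulrC.
  by apply: LD => //; exact: (Lfun_scale _ (lexx 1)).
rewrite (_ : (fun w => _) =
  (c i \o* Y i) \+ (fun w => \sum_(j <- s) c j * Y j w)); last first.
  by apply/funext => w; rewrite big_cons mulrC.
rewrite expectationD ?expectationZl ?(Lfun_scale _ (lexx 1)) // IHs big_cons.
by rewrite EFinD EFinM fineK // expectation_fin_num.
Qed.

(** Entry (i, j) of f X as a linear combination of the entries of X. Through
    this formula, one lemma on linear combinations covers left and right
    products, transposition and their composites. *)
Lemma linear_mxE (p q p' q' : nat) (f : {linear 'M[R]_(p, q) -> 'M[R]_(p', q')})
    (X : 'M[R]_(p, q)) (i : 'I_p') (j : 'I_q') :
  f X i j = \sum_(k : 'I_p * 'I_q) f (delta_mx k.1 k.2) i j * X k.1 k.2.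
Proof.
rewrite {1}[X]matrix_sum_delta linear_sum summxE.
rewrite -(pair_big xpredT xpredT (fun k l => f (delta_mx k l) i j * X k l)) /=.
apply: eq_bigr => k _; rewrite linear_sum summxE; apply: eq_bigr => l _.
by rewrite linearZ mxE mulrC.
Qed.

Lemma mx_Lfun_linear (r : R) (p q p' q' : nat)
    (f : {linear 'M[R]_(p, q) -> 'M[R]_(p', q')}) (X : T -> 'M[R]_(p, q)) :
  1 <= r -> mx_Lfun r X -> mx_Lfun r (fun w => f (X w)).
Proof.
move=> r1 LX i j; under eq_fun do rewrite linear_mxE.
exact: (@Lfun_lincomb _ _ _ (fun k w => X w k.1 k.2)).
Qed.

Lemma expectation_mx_linear (p q p' q' : nat)
    (f : {linear 'M[R]_(p, q) -> 'M[R]_(p', q')}) (X : T -> 'M[R]_(p, q)) :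
  mx_Lfun 1 X ->
  expectation_mx P (fun w => f (X w)) = f (expectation_mx P X).
Proof.
move=> LX; apply/matrixP => i j; rewrite mxE [RHS]linear_mxE.
under [X in ('E_P[X])%E]eq_fun do rewrite linear_mxE.
rewrite (@expectation_lincomb _ _ (fun k w => X w k.1 k.2)) //=.
by apply: eq_bigr => k _; rewrite mxE.
Qed.

Lemma mx_LfunD (r : R) (p q : nat) (X Y : T -> 'M[R]_(p, q)) :
  1 <= r -> mx_Lfun r X -> mx_Lfun r Y -> mx_Lfun r (fun w => X w + Y w).
Proof.
move=> r1 LX LY i j; under eq_fun do rewrite mxE.
have r1E : (1 <= r%:E)%E by rewrite lee_fin.
by have [_ LD] := Lfun_addr_closed P r1E; exact: LD.
Qed.

Lemma expectation_mxD (p q : nat) (X Y : T -> 'M[R]_(p, q)) :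
  mx_Lfun 1 X -> mx_Lfun 1 Y ->
  expectation_mx P (fun w => X w + Y w)
    = expectation_mx P X + expectation_mx P Y.
Proof.
move=> LX LY; apply/matrixP => i j; rewrite !mxE.
under [X in ('E_P[X])%E]eq_fun do rewrite mxE.
by rewrite (expectationD (LX i j) (LY i j)) fineD // expectation_fin_num.
Qed.

Lemma mx_Lfun_cst (r : R) (p q : nat) (C : 'M[R]_(p, q)) :
  mx_Lfun r (fun=> C).
Proof. by move=> i j; exact: Lfun_cst. Qed.

Lemma expectation_mx_cst (p q : nat) (C : 'M[R]_(p, q)) :
  expectation_mx P (fun=> C) = C.
Proof. by apply/matrixP => i j; rewrite mxE (expectation_cst P (C i j)). Qed.

Lemma mx_Lfun2_Lfun1 (p q : nat) (X : T -> 'M[R]_(p, q)) :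
  mx_Lfun 2 X -> mx_Lfun 1 X.
Proof.
move=> LX i j; apply: Lfun_subset12; last exact: LX.
exact: fin_num_measure.
Qed.

Lemma mx_Lfun_outer (p q : nat) (u : T -> 'cV[R]_p) (v : T -> 'cV[R]_q) :
  mx_Lfun 2 u -> mx_Lfun 2 v -> mx_Lfun 1 (fun w => u w *m (v w)^T).
Proof.
move=> Lu Lv i j; under eq_fun do rewrite mxE big_ord1 mxE.
exact: Lfun2_mul_Lfun1.
Qed.

Lemma enorm_sqr (n : nat) (v : 'cV[R]_n) : enorm v ^+ 2 = \tr (v *m v^T).
Proof.
rewrite /enorm sqr_sqrtr; last by rewrite sumr_ge0 // => i _; exact: sqr_ge0.
by apply: eq_bigr => i _; rewrite mxE big_ord1 mxE expr2.
Qed.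

Lemma expectation_enorm_sqr (n : nat) (u : T -> 'cV[R]_n) :
  mx_Lfun 2 u ->
  ('E_P[fun w => (enorm (u w) ^+ 2)%R]
    = (\tr (expectation_mx P (fun w => (u w *m (u w)^T)%R)))%:E)%E.
Proof.
move=> Lu; have Luu := mx_Lfun_outer Lu Lu.
rewrite (_ : (fun w => _) =
  fun w => \sum_i 1 * (u w *m (u w)^T) i i); last first.
  by apply/funext => w; rewrite enorm_sqr; under [RHS]eq_bigr do rewrite mul1r.
rewrite (@expectation_lincomb _ _ (fun i w => (u w *m (u w)^T) i i)) //.
by congr _%:E; apply: eq_bigr => i _; rewrite mxE mul1r.
Qed.

(** Each squared coordinate is bounded by the squared Euclidean norm. *)
Lemma square_integrable_Lfun (n : nat) (u : T -> 'cV[R]_n) :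
  square_integrable P u -> mx_Lfun 2 u.
Proof.
move=> [mu Eu] i j; rewrite ord1 {j}.
rewrite inE; apply/andP; split; rewrite inE /=; first exact: mu.
rewrite /finite_norm unlock; apply: poweR_lty.
apply: le_lt_trans Eu; rewrite unlock.
have mE : measurable_fun [set: T] (fun w => enorm (u w) ^+ 2).
  rewrite (_ : (fun w => _) = fun w => \sum_i u w i 0 ^+ 2).
    by apply: measurable_sum => k; exact: measurable_funX.
  apply/funext => w; rewrite /enorm sqr_sqrtr // sumr_ge0 // => k _.
  exact: sqr_ge0.
apply: ge0_le_integral => //=.
- apply/measurable_EFinP.
  apply: (@measurableT_comp _ _ _ _ _ _ (fun x : R => x `^ 2)%R) => //.
  by apply: measurableT_comp => //; exact: mu.
- exact/measurable_EFinP.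
- move=> w _; rewrite lee_fin powR_mulrn // real_normK ?num_real //.
  rewrite /enorm sqr_sqrtr; last by rewrite sumr_ge0 // => k _; exact: sqr_ge0.
  by rewrite (bigD1 i) //= lerDl sumr_ge0 // => k _; exact: sqr_ge0.
Qed.

(** The terms H z c^T and c z^T H^T of the product are linear in z, so their
    expectation vanishes with that of z. *)
Lemma expectation_outer_affine (p q : nat) (z : T -> 'cV[R]_p)
    (H : 'M[R]_(q, p)) (c : 'cV[R]_q) :
  mx_Lfun 2 z -> expectation_mx P z = 0 ->
  expectation_mx P (fun w => (H *m z w + c) *m (H *m z w + c)^T)
    = H *m expectation_mx P (fun w => z w *m (z w)^T) *m H^T + c *m c^T.
Proof.
move=> Lz Ez; pose V w := z w *m (z w)^T.
have LV : mx_Lfun 1 V by exact: mx_Lfun_outer.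
have Lz1 := mx_Lfun2_Lfun1 Lz.
pose f := mulmxr H^T \o mulmx H : {linear 'M[R]_p -> 'M[R]_q}.
pose g := mulmxr c^T \o mulmx H : {linear 'cV[R]_p -> 'M[R]_q}.
pose h := trmx \o g : {linear 'cV[R]_p -> 'M[R]_q}.
rewrite (_ : (fun w => _) =
    fun w => f (V w) + (g (z w) + (h (z w) + c *m c^T))); last first.
  apply/funext => w; rewrite /f /g /h /V /= linearD /= !trmx_mul trmxK.
  by rewrite mulmxDl !mulmxDr !mulmxA !addrA.
have Lc : mx_Lfun 1 (fun=> c *m c^T) by exact: mx_Lfun_cst.
have LL p' q' (l : {linear 'M[R]_(p', q') -> 'M[R]_q}) X :
  mx_Lfun 1 X -> mx_Lfun 1 (fun w => l (X w)) by exact: mx_Lfun_linear.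
rewrite !expectation_mxD; do ?[exact: LL | exact: Lc | apply: mx_LfunD => //].
rewrite (expectation_mx_linear f LV) (expectation_mx_linear g Lz1).
by rewrite (expectation_mx_linear h Lz1) expectation_mx_cst Ez !linear0 !add0r.
Qed.

Lemma mx_Lfun_center (p q : nat) (X : T -> 'M[R]_(p, q)) :
  mx_Lfun 2 X -> mx_Lfun 2 (fun w => X w - expectation_mx P X).
Proof.
move=> LX; apply: mx_LfunD LX _; first by rewrite ler1n.
exact: mx_Lfun_cst.
Qed.

Lemma expectation_mx_center (p q : nat) (X : T -> 'M[R]_(p, q)) :
  mx_Lfun 1 X -> expectation_mx P (fun w => X w - expectation_mx P X) = 0.
Proof.
move=> LX; rewrite expectation_mxD //; last exact: mx_Lfun_cst.
by rewrite expectation_mx_cst subrr.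
Qed.

(** The quadratic form of the covariance at v is the expectation of the square
    of v (x - E x). *)
Lemma covariance_psd (n : nat) (x : T -> 'cV[R]_n) :
  mx_Lfun 2 x -> psdmx (covariance_mx P x).
Proof.
move=> Lx; have Lxc := mx_Lfun_center Lx.
have Exc := expectation_mx_center (mx_Lfun2_Lfun1 Lx).
split.
  apply/matrixP => i j; rewrite !mxE; congr (fine (expectation P _)).
  apply/funext => w; rewrite !mxE; apply: eq_bigr => k _.
  by rewrite ![(_^T) _ _]mxE mulrC.
move=> v; have := expectation_outer_affine v 0 Lxc Exc.
rewrite mul0mx addr0 => <-.
rewrite -lee_fin -expectation_enorm_sqr.
  by apply: expectation_ge0 => w; exact: sqr_ge0.
apply: mx_LfunD; rewrite ?ler1n //; last exact: mx_Lfun_cst.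
by apply: (@mx_Lfun_linear _ _ _ _ _ (mulmx v)) => //; rewrite ler1n.
Qed.

Lemma expectation_mx_col (p1 p2 q : nat) (X : T -> 'M[R]_(p1, q))
    (Y : T -> 'M[R]_(p2, q)) :
  expectation_mx P (fun w => col_mx (X w) (Y w))
    = col_mx (expectation_mx P X) (expectation_mx P Y).
Proof.
apply/matrixP => i j; rewrite -[i]splitK mxE.
case: (fintype.split i) => k /=; rewrite ?(col_mxEu, col_mxEd) mxE;
  by under eq_fun do rewrite ?(col_mxEu, col_mxEd).
Qed.

Lemma expectation_mx_row (p q1 q2 : nat) (X : T -> 'M[R]_(p, q1))
    (Y : T -> 'M[R]_(p, q2)) :
  expectation_mx P (fun w => row_mx (X w) (Y w))
    = row_mx (expectation_mx P X) (expectation_mx P Y).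
Proof.
apply/matrixP => i j; rewrite -[j]splitK mxE.
case: (fintype.split j) => k /=; rewrite ?(row_mxEl, row_mxEr) mxE;
  by under eq_fun do rewrite ?(row_mxEl, row_mxEr).
Qed.

Lemma expectation_mx_tr (p q : nat) (X : T -> 'M[R]_(p, q)) :
  expectation_mx P (fun w => (X w)^T) = (expectation_mx P X)^T.
Proof.
by apply/matrixP => i j; rewrite !mxE; under eq_fun do rewrite mxE.
Qed.

Lemma cross_covariance_mx_centered (p q : nat) (x : T -> 'cV[R]_p)
    (y : T -> 'cV[R]_q) :
  expectation_mx P x = 0 -> expectation_mx P y = 0 ->
  cross_covariance_mx P x y = expectation_mx P (fun w => x w *m (y w)^T).
Proof.
by move=> Ex Ey; rewrite /cross_covariance_mx Ex Ey;
  under eq_fun do rewrite !subr0.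
Qed.

Lemma expectation_outer_col (p q : nat) (x : T -> 'cV[R]_p)
    (y : T -> 'cV[R]_q) :
  expectation_mx P x = 0 -> expectation_mx P y = 0 -> uncorrelated P x y ->
  expectation_mx P (fun w => col_mx (x w) (y w) *m (col_mx (x w) (y w))^T)
    = block_mx (covariance_mx P x) 0 0 (covariance_mx P y).
Proof.
rewrite /uncorrelated /covariance_mx => Ex Ey.
rewrite !cross_covariance_mx_centered // => Exy.
rewrite (_ : (fun w => _ *m _) = fun w =>
  col_mx (row_mx (x w *m (x w)^T) (x w *m (y w)^T))
         (row_mx (x w *m (y w)^T)^T (y w *m (y w)^T))); last first.
  by apply/funext => w; rewrite tr_col_mx mul_col_row trmx_mul trmxK.
by rewrite expectation_mx_col !expectation_mx_row expectation_mx_tr Exy trmx0.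
Qed.

End MatrixExpectation.

(** * The bilevel problem *)

Section Risk.
Context (R : realType) (m n : nat).
Variable A : 'M[R]_(m, n).
Local Notation B := (A^T *m A).

(** The matrix K such that, with x0 = 0, the reconstruction from noiseless data
    is K x. The risk depends on M through K alone, apart from the bias. *)
Definition gain (M : 'M[R]_n) : 'M[R]_n := invmx (B + M) *m B.

Lemma gain_compl (M : 'M[R]_n) :
  feasible A M -> 1%:M - gain M = invmx (B + M) *m M.
Proof.
rewrite /gain => Mu; apply/eqP.
by rewrite subr_eq -mulmxDr [M + _]addrC mulVmx.
Qed.

Lemma reconstruction_error (M : 'M[R]_n) (x0 x mu : 'cV[R]_n) (e : 'cV[R]_m) :
  feasible A M ->
  reconstruction A M x0 (A *m x + e) - x =
    row_mx (- (1%:M - gain M)) (invmx (B + M) *m A^T) *m col_mx (x - mu) e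
    + (1%:M - gain M) *m (x0 - mu).
Proof.
move=> /gain_compl; rewrite /reconstruction /gain; set G := invmx _ => GM.
have GBx : G *m A^T *m A *m x = x - G *m M *m x.
  by rewrite -GM mulmxBl mul1mx opprB addrC subrK !mulmxA.
rewrite GM mul_row_col mulNmx -mulmxN opprB addrAC -mulmxDr.
rewrite [mu - x + _]addrC addrA subrK !(mulmxDr, mulmxN) !mulmxA GBx.
by rewrite [LHS]addrC !addrA addNr add0r [LHS]addrC addrA.
Qed.

(** The noise term in terms of the gain: (B + M)^-1 = gain M B^-1, and B^-1 is
    symmetric. *)
Lemma gain_noise (M : 'M[R]_n) (N : 'M[R]_m) :
  B \in unitmx ->
  gain M *m (invmx B *m (A^T *m N *m A) *m invmx B) *m (gain M)^T =
  (invmx (B + M) *m A^T) *m N *m (invmx (B + M) *m A^T)^T.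
Proof.
move=> Bu; have Bs : B^T = B by rewrite trmx_mul trmxK.
have gB : gain M *m invmx B = invmx (B + M) by rewrite /gain mulmxK.
have Bg : invmx B *m (gain M)^T = (invmx (B + M))^T.
  by rewrite -gB [RHS]trmx_mul trmx_inv Bs.
by rewrite !mulmxA gB -[_ *m invmx B *m _]mulmxA Bg trmx_mul trmxK !mulmxA.
Qed.

Context (d : measure_display) (T : measurableType d).
Variables (P : probability T R) (x : T -> 'cV[R]_n) (eps : T -> 'cV[R]_m).

(** The error is affine in the stacked vector (x - E x, eps), whose second
    moment is block diagonal; the summand in c is the squared bias. *)
Lemma bilevel_riskE (M : 'M[R]_n) (x0 : 'cV[R]_n) :
  square_integrable P x -> square_integrable P eps ->
  uncorrelated P x eps -> expectation_mx P eps = 0 ->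
  B \in unitmx -> feasible A M ->
  let c := (1%:M - gain M) *m (x0 - expectation_mx P x) in
  bilevel_risk A P x eps M x0 =
    (\tr (error_covariance (covariance_mx P x)
             (invmx B *m (A^T *m covariance_mx P eps *m A) *m invmx B) (gain M))
     + \tr (c *m c^T))%:E.
Proof.
move=> x2 e2 xe Ee Bu Mu c; rewrite /bilevel_risk.
have Lx := square_integrable_Lfun x2; have Le := square_integrable_Lfun e2.
pose xc w := x w - expectation_mx P x.
have Lxc : mx_Lfun P 2 xc by exact: mx_Lfun_center.
have Exc : expectation_mx P xc = 0.
  by apply: expectation_mx_center; exact: mx_Lfun2_Lfun1.
have Sxc : covariance_mx P xc = covariance_mx P x.
  by rewrite /covariance_mx cross_covariance_mx_centered.
have xce : uncorrelated P xc eps.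
  rewrite /uncorrelated cross_covariance_mx_centered // -[RHS]xe.
  by rewrite /cross_covariance_mx Ee; under [in RHS]eq_fun do rewrite subr0.
pose z w := col_mx (xc w) (eps w).
have Lz : mx_Lfun P 2 z.
  move=> i j; rewrite -[i]splitK; case: (fintype.split i) => k /=.
    by under eq_fun do rewrite col_mxEu; exact: Lxc.
  by under eq_fun do rewrite col_mxEd; exact: Le.
have Ez : expectation_mx P z = 0.
  by rewrite expectation_mx_col Exc Ee col_mx0.
pose H := row_mx (- (1%:M - gain M)) (invmx (B + M) *m A^T).
under eq_fun do rewrite (reconstruction_error _ _ (expectation_mx P x)) //.
rewrite (@expectation_enorm_sqr _ _ _ _ _ (fun w => H *m z w + c)); last first.
  apply: mx_LfunD; rewrite ?ler1n //; last exact: mx_Lfun_cst.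
  by apply: (@mx_Lfun_linear _ _ _ _ _ _ _ _ _ (mulmx H)); rewrite ?ler1n.
rewrite expectation_outer_affine // linearD /= expectation_outer_col // Sxc.
rewrite /H mul_row_block tr_row_mx mul_row_col !mulmx0 addr0 add0r.
by rewrite linearN /= !(mulNmx, mulmxN) opprK -gain_noise.
Qed.

End Risk.

Theorem theorem5p1 (R : realType) (d : measure_display) (T : measurableType d)
    (P : probability T R) (m n : nat) (A : 'M[R]_(m, n))
    (x : T -> 'cV[R]_n) (eps : T -> 'cV[R]_m)
    (mu : 'cV[R]_n) (Sigma_x : 'M[R]_n) (Sigma_eps : 'M[R]_m)
    (x_sqint : square_integrable P x)
    (eps_sqint : square_integrable P eps)
    (x_eps_uncorr : uncorrelated P x eps)
    (x_mean : expectation_mx P x = mu)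
    (x_cov : covariance_mx P x = Sigma_x)
    (eps_mean : expectation_mx P eps = 0)
    (eps_cov : covariance_mx P eps = Sigma_eps)
    (ATA_unit : A^T *m A \in unitmx)
    (Sigma_x_unit : Sigma_x \in unitmx)
    (Sigma_eps_unit : Sigma_eps \in unitmx)
    (M : 'M[R]_n) (x0 : 'cV[R]_n) :
  x0 \in [set mu + z | z in colker M] ->
  M = A^T *m Sigma_eps *m A *m invmx (A^T *m A) *m invmx Sigma_x ->
  solves_bilevel A P x eps M x0.
Proof.
rewrite inE => -[z zM x0E] ME.
pose B := A^T *m A; pose Q := invmx B *m (A^T *m Sigma_eps *m A) *m invmx B.
have Bs : B^T = B by rewrite trmx_mul trmxK.
have S_psd : psdmx Sigma_x.
  by rewrite -x_cov; apply: covariance_psd; exact: square_integrable_Lfun.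
have Q_psd : psdmx Q.
  rewrite /Q -{2}Bs -trmx_inv; apply: psdmx_congr.
  rewrite -{2}[A]trmxK; apply: psdmx_congr.
  by rewrite -eps_cov; apply: covariance_psd; exact: square_integrable_Lfun.
have SQ_unit := psdmxD_unit S_psd Q_psd Sigma_x_unit.
have BME : B + M = B *m (Sigma_x + Q) *m invmx Sigma_x.
  rewrite mulmxDr mulmxDl mulmxK // /Q !mulmxA mulmxV // mul1mx.
  by rewrite ME.
have M_feasible : feasible A M.
  by rewrite /feasible BME !unitmx_mul ATA_unit SQ_unit unitmx_inv Sigma_x_unit.
have gainE : gain A M *m (Sigma_x + Q) = Sigma_x.
  rewrite /gain -mulmxA -[B *m _](mulmxKV Sigma_x_unit) -BME.
  by rewrite mulmxA mulVmx // mul1mx.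
have bias0 : (1%:M - gain A M) *m (x0 - mu) = 0.
  by rewrite gain_compl // -x0E [mu + z]addrC addrK -mulmxA zM mulmx0.
(* At M the bias is 0 and the gain solves the normal equation, so the excess
   risk of (M', x0') is a squared bias plus the completed square. *)
split=> // M' x0' M'_feasible.
rewrite !bilevel_riskE // x_mean x_cov eps_cov bias0 mul0mx linear0 addr0.
rewrite lee_fin (error_covariance_square (gain A M') S_psd.1 Q_psd.1 gainE).
rewrite [\tr (error_covariance _ _ _ + _)]linearD /= -addrA lerDl.
rewrite addr_ge0 //; last by rewrite -enorm_sqr sqr_ge0.
apply: mxtrace_congr_psd_ge0; exact: psdmxD.
Qed.
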